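(* For the periodic quantum graph of the truncated square tiling with edge length $a$ and potentials $q_1,\dots,q_6$ on its six classes of edges, the characteristic function is $$\begin{aligned}\Phi(\rho)=e^{i\theta_1+i\theta_2}\big\{&\big(S_5'S_2S_3+S_5(CS)_{23}\big)\big(C_1'(S_4S_6)'+S_1'(C_4S_6)'+S_1(C_4C_6)'+C_1(S_4C_6)'-2\cos\theta_2\big)\\&+(CSS)_{145}\big(S_2'(C_3S_6)'+C_2'(S_3S_6)'+C_6(CS)_{23'}-2\cos\theta_2\big)\\&+\big(C_6S_1S_2+S_6(S_1S_2)'\big)\big(C_5'(S_3S_4)'+C_3S_4'C_5+S_3'C_4S_5'-2\cos\theta_1\big)\\&+(S_3S_4S_6)'\big(C_1S_2'S_5'+S_1'C_2C_5-2\cos\theta_1\big)\\&+S_5S_6\big((SC)_{14'}(SC)_{32'}+(SC)_{41'}(SC)_{23'}-2\big)\\&+S_2S_4\big((S_1'S_6'+S_1C_6')(C_3C_5+S_3C_5')+S_6(C_1'S_3'S_5'+S_1'C_3'C_5)+C_1C_6S_3'S_5'-2\cos(\theta_1-\theta_2)\big)\\&+S_1S_3\big(S_2'S_6'(CS)_{45'}+C_2C_5(S_4C_6)'+S_6(C_2'S_4'C_5+S_2'C_4'S_5')-2\cos(\theta_1+\theta_2)\big)\big\}.\end{aligned}$$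
   Context: Let $a>0$, $q_1,\dots,q_6\in L^2(0,a)$ real-valued (not assumed identical or even), $\rho\in\mathbb C$, $\lambda=\rho^2$. Let $C_j(x,\rho),S_j(x,\rho)$ be the solutions of $-y''+q_jy=\rho^2y$ on $[0,a]$ with $C_j(0,\rho)=S_j'(0,\rho)=1$, $C_j'(0,\rho)=S_j(0,\rho)=0$; abbreviate $C_j=C_j(a,\rho)$, $C_j'=C_j'(a,\rho)$, $S_j=S_j(a,\rho)$, $S_j'=S_j'(a,\rho)$. A prime on a product denotes the product rule, e.g. $(C_4S_6)'=C_4'S_6+C_4S_6'$, $(S_3S_4S_6)'=S_3'S_4S_6+S_3S_4'S_6+S_3S_4S_6'$. Further, $(CS)_{ij}=C_iS_j+S_iC_j$, $(CS)_{ij'}=(SC)_{ij'}=C_iS_j'+S_iC_j'$, $(CSS)_{ijk}=C_iS_jS_k+C_jS_kS_i+C_kS_iS_j$. The graph is periodic with respect to $\vec k_1=(0,(1+\sqrt2)a)$, $\vec k_2=((1+\sqrt2)a,0)$; modulo translations it has vertices $v_1,\dots,v_4$ and edges $e_1:v_1\to v_2$, $e_2:v_3\to v_2$, $e_3:v_3\to v_4$, $e_4:v_1\to v_4$, $e_5:v_1\to v_3-\vec k_1$, $e_6:v_2\to v_4-\vec k_2$, each parametrized by $[0,a]$ in the indicated direction and carrying potential $q_j$. For a quasi-momentum $\Theta=(\theta_1,\theta_2)\in[-\pi,\pi]^2$, the Bloch Hamiltonian $H^\Theta$ acts as $-y''+q_jy$ on edges, on functions satisfying the continuity–Kirchhoff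 condition at vertices and $y(x+p_1\vec k_1+p_2\vec k_2)=e^{i(p_1\theta_1+p_2\theta_2)}y(x)$, $p_1,p_2\in\mathbb Z$. Writing $y_j=A_jC_j(x,\rho)+B_jS_j(x,\rho)$ on $e_j$, and $\widetilde\alpha=e^{i\theta_1}$, $\widetilde\beta=e^{i\theta_2}$, these conditions become a homogeneous linear system in the unknowns ordered $(A_1,\dots,A_6,B_1,\dots,B_6)$. The characteristic function $\Phi(\rho)$ is the determinant of the $12\times12$ matrix whose rows are, in order, the coefficients of the linear forms 1. $A_1-A_4$ 2. $A_1-A_5$ 3. $B_1+B_4+B_5$ 4. $C_1A_1-A_6+S_1B_1$ 5. $C_2A_2-A_6+S_2B_2$ 6. $C_1'A_1+C_2'A_2+S_1'B_1+S_2'B_2-B_6$ 7. $A_2-A_3$ 8. $-A_2+\widetilde\alpha C_5A_5+\widetilde\alpha S_5B_5$ 9. $\widetilde\alpha C_5'A_5-B_2-B_3+\widetilde\alpha S_5'B_5$ 10. $-C_3A_3+C_4A_4-S_3B_3+S_4B_4$ 11. $-C_3A_3+\widetilde\beta C_6A_6-S_3B_3+\widetilde\beta S_6B_6$ 12. $C_3'A_3+C_4'A_4+\widetilde\beta C_6'A_6+S_3'B_3+S_4'B_4+\widetilde\beta S_6'B_6$. Thus $\rho^2\in\sigma(H^\Theta)$ if and only if $\Phi(\rho)=0$. *)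

(* Defs.v *)
From HB Require Import structures.
From mathcomp Require Import all_boot all_order all_algebra.
From mathcomp Require Export complex.
From mathcomp Require Import all_classical all_reals all_analysis.

Set Implicit Arguments.
Unset Strict Implicit.
Unset Printing Implicit Defensive.

Import Order.TTheory GRing.Theory Num.Theory.
Import numFieldNormedType.Exports.

Local Open Scope classical_set_scope.
Local Open Scope ring_scope.
Local Open Scope complex_scope.

Section ComplexIntegration.
Context {R : realType}.
Local Notation mu := (@lebesgue_measure R).

Definition expi (t : R) : R[i] := cos t +i* sin t.

Definition cintegrable (D : set R) (f : R -> R[i]) : Prop :=
  mu.-integrable D (EFin \o (fun x => complex.Re (f x))) /\
  mu.-integrable D (EFin \o (fun x => complex.Im (f x))).

Definition cintegral (D : set R) (f : R -> R[i]) : R[i] :=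
  (\int[mu]_(x in D) complex.Re (f x)) +i* (\int[mu]_(x in D) complex.Im (f x)).

(* f is absolutely continuous on [0, a], with derivative f' almost
   everywhere. *)
Definition ac_derivative (a : R) (f f' : R -> R[i]) : Prop :=
  cintegrable `[0, a] f' /\
  forall x, x \in `[0, a] -> f x = f 0 + cintegral `[0, x] f'.

End ComplexIntegration.

Section SturmLiouville.
Context {R : realType}.
Local Notation mu := (@lebesgue_measure R).

Definition square_integrable (a : R) (q : R -> R) : Prop :=
  measurable_fun `]0, a[ q /\
  mu.-integrable `]0, a[ (EFin \o (fun x => q x ^+ 2)).

(* y' is absolutely continuous, hence continuous, so that it is the classical
   derivative of y on [0, a], one-sided at 0 and a; in particular y' a is the
   left derivative at a, which the two-sided operator derive1 would not give. *)
Definition SL_solution (a : R) (q : R -> R) (lambda : R[i])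
    (y y' : R -> R[i]) : Prop :=
  exists y'' : R -> R[i],
    [/\ ac_derivative a y y',
        ac_derivative a y' y'' &
        {ae mu, forall x, x \in `]0, a[ ->
           - y'' x + (q x)%:C * y x = lambda * y x}].

Definition SL_cauchy (a : R) (q : R -> R) (lambda y0 y0' : R[i])
    (y y' : R -> R[i]) : Prop :=
  [/\ SL_solution a q lambda y y', y 0 = y0 & y' 0 = y0'].

End SturmLiouville.

Definition e1 : 'I_6 := @Ordinal 6 0 isT.
Definition e2 : 'I_6 := @Ordinal 6 1 isT.
Definition e3 : 'I_6 := @Ordinal 6 2 isT.
Definition e4 : 'I_6 := @Ordinal 6 3 isT.
Definition e5 : 'I_6 := @Ordinal 6 4 isT.
Definition e6 : 'I_6 := @Ordinal 6 5 isT.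

Section TruncatedSquareTiling.
Context {K : comNzRingType}.

(* The continuity and Kirchhoff conditions at v1, v2, v3, v4 for the functions
   A j * C_j(x) + B j * S_j(x) on the edges
     e1 : v1 -> v2,       e2 : v3 -> v2,       e3 : v3 -> v4,
     e4 : v1 -> v4,       e5 : v1 -> v3 - k1,  e6 : v2 -> v4 - k2,
   where C, C', S, S' are the values at x = a and alpha, beta are the Floquet
   multipliers of the translations by k1, k2. *)
Definition vertex_forms (alpha beta : K) (C C' S S' : 'I_6 -> K)
    (A B : 'I_6 -> K) : seq K :=
  [:: (* v1 *)
      A e1 - A e4;
      A e1 - A e5;
      B e1 + B e4 + B e5;
      (* v2 *)
      C e1 * A e1 - A e6 + S e1 * B e1;
      C e2 * A e2 - A e6 + S e2 * B e2;
      C' e1 * A e1 + C' e2 * A e2 + S' e1 * B e1 + S' e2 * B e2 - B e6;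
      (* v3 *)
      A e2 - A e3;
      - A e2 + alpha * C e5 * A e5 + alpha * S e5 * B e5;
      alpha * C' e5 * A e5 - B e2 - B e3 + alpha * S' e5 * B e5;
      (* v4 *)
      - C e3 * A e3 + C e4 * A e4 - S e3 * B e3 + S e4 * B e4;
      - C e3 * A e3 + beta * C e6 * A e6 - S e3 * B e3 + beta * S e6 * B e6;
      C' e3 * A e3 + C' e4 * A e4 + beta * C' e6 * A e6
        + S' e3 * B e3 + S' e4 * B e4 + beta * S' e6 * B e6].

(* Column j holds the values of the forms at the j-th basis vector, for the
   unknowns ordered as A_1, ..., A_6, B_1, ..., B_6. *)
Definition vertex_matrix (alpha beta : K) (C C' S S' : 'I_6 -> K) : 'M[K]_12 :=
  \matrix_(i < 12, j < 6 + 6)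
    (vertex_forms alpha beta C C' S S'
       (fun k => (j == lshift 6 k)%:R) (fun k => (j == rshift 6 k)%:R))`_i.

(* Derivatives of products of functions given as pairs (value, derivative). *)
Definition der2 (u v : K * K) : K := u.2 * v.1 + u.1 * v.2.

Definition der3 (u v w : K * K) : K :=
  u.2 * v.1 * w.1 + u.1 * v.2 * w.1 + u.1 * v.1 * w.2.

End TruncatedSquareTiling.

Definition char_fun (R : realType) (a theta1 theta2 : R)
    (C C' S S' : 'I_6 -> R -> R[i] -> R[i]) (rho : R[i]) : R[i] :=
  \det (vertex_matrix (expi theta1) (expi theta2)
          (fun j => C j a rho) (fun j => C' j a rho)
          (fun j => S j a rho) (fun j => S' j a rho)).

(* Main.v *)
(* Laplace expansion of the sparse 12 x 12 determinant gives a polynomial in the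
   values C_j, C_j', S_j, S_j' at a and in the Floquet multipliers; it agrees
   with the stated formula modulo the six Wronskian relations
   C_j S_j' - S_j C_j' = 1 and Euler's formula. Since potentials are only L^2,
   the Wronskian is shown to be constant through the product rule for
   absolutely continuous functions, i.e. Fubini's theorem on {y <= x}. *)

Require Import Defs.
From HB Require Import structures.
From mathcomp Require Import all_boot all_order all_algebra.
From mathcomp Require Import complex.
From mathcomp Require Import all_classical all_reals all_analysis.
From mathcomp Require Import measurable_realfun ring lra.

Set Implicit Arguments.
Unset Strict Implicit.
Unset Printing Implicit Defensive.

Import Order.TTheory GRing.Theory Num.Theory.
Import numFieldNormedType.Exports.

Local Open Scope classical_set_scope.
Local Open Scope ring_scope.
Local Open Scope complex_scope.

(** * Laplace expansion of matrices with structural zeros *)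

Section SparseDeterminant.
Context {K : comNzRingType}.
Implicit Types (x y : option K) (r : seq (option K)).

(* An entry [None] is a structural zero, so that evaluating [sparse_det] only
   visits the products that avoid the zero entries. *)
Definition sparse_mul x y : option K :=
  if x is Some a then if y is Some b then Some (a * b) else None else None.

Definition sparse_sub x y : option K :=
  match x, y with
  | Some a, Some b => Some (a - b)
  | Some a, None => Some a
  | None, Some b => Some (- b)
  | None, None => None
  end.

(** Nesting the subtractions, [x0 m0 - (x1 m1 - (x2 m2 - ...))], produces the alternating signs of
    the expansion. The entry is inspected before its minor, so no minor of a structural zero is
    evaluated. *)
Definition sparse_row_sum (minor : nat -> option K) :=
  fix sum r j : option K :=
    if r is x :: r' then
      sparse_sub (if x is Some _ then sparse_mul x (minor j) else None)
                 (sum r' j.+1)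
    else None.

Definition drop_col j r := take j r ++ drop j.+1 r.

(** The row is cut to length [n] to match [sparse_mx], which ignores surplus columns and reads
    missing entries as zero; correctness thus holds for lists of any shape. *)
Fixpoint sparse_det n (M : seq (seq (option K))) : option K :=
  if n is n'.+1 then
    if M is r :: M' then
      sparse_row_sum (fun j => sparse_det n' (map (drop_col j) M'))
        (take n r) 0
    else None
  else Some 1.

Definition sparse_mx n (M : seq (seq (option K))) : 'M[K]_n :=
  \matrix_(i < n, j < n) odflt 0 (nth None (nth [::] M i) j).

Lemma odflt_sparse_mul x y :
  odflt 0 (sparse_mul x y) = odflt 0 x * odflt 0 y.
Proof. by case: x y => [a|] [b|] //=; rewrite ?mulr0 ?mul0r. Qed.

Lemma odflt_sparse_sub x y :
  odflt 0 (sparse_sub x y) = odflt 0 x - odflt 0 y.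
Proof. by case: x y => [a|] [b|] //=; rewrite ?subr0 ?sub0r. Qed.

Lemma odflt_sparse_row_sum minor r j n : (size r <= n)%N ->
  odflt 0 (sparse_row_sum minor r j) =
  \sum_(i < n) (-1) ^+ i * (odflt 0 (nth None r i) * odflt 0 (minor (j + i)%N)).
Proof.
elim: r j n => [|x r IHr] j n /=.
  by move=> _; rewrite big1// => i _; rewrite nth_nil/= mul0r mulr0.
case: n => // n rn; rewrite odflt_sparse_sub (IHr j.+1 n)//.
rewrite big_ord_recl/= expr0 mul1r addn0; congr (_ + _).
  by case: x => [a|]; rewrite ?odflt_sparse_mul //= mul0r.
rewrite -sumrN; apply: eq_bigr => i _.
by rewrite /bump/= exprS mulN1r mulNr addSnnS.
Qed.

(** [bump j] is the index map behind [lift], through which [cofactor] deletes column [j]. Beyond the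
    end of [r] both sides are the default [None]. *)
Lemma nth_drop_col j r k :
  nth None (drop_col j r) k = nth None r (bump j k).
Proof.
rewrite /drop_col nth_cat size_take_min /bump.
have [jk|kj] := leqP j k.
  rewrite ltnNge (leq_trans (geq_minl _ _) jk) /=.
  have [jr|rj] := leqP j (size r).
    by rewrite nth_drop addSn subnKC// add1n.
  rewrite drop_oversize ?nth_nil ?nth_default//; last exact: leqW (ltnW rj).
  by rewrite (leq_trans (ltnW rj))// (leq_trans jk)// leq_addl.
rewrite add0n leq_min kj/=; case: ltnP => [kr|rk]; first by rewrite nth_take.
rewrite drop_oversize ?nth_nil ?nth_default//.
by rewrite (leq_trans rk)// (leq_trans (ltnW kj)).
Qed.

(** Induction on [n], expanding along the first row: deleting that row and column [j] of [sparse_mx]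
    gives the [sparse_mx] of the shortened lists. *)
Lemma det_sparse_mx n M : \det (sparse_mx n M) = odflt 0 (sparse_det n M).
Proof.
elim: n M => [|n IHn] M; first by rewrite det_mx00.
rewrite (expand_det_row _ ord0).
case: M => [|r M] /=.
  by rewrite big1// => j _; rewrite !mxE !nth_nil mul0r.
rewrite (@odflt_sparse_row_sum _ _ _ n.+1); last first.
  by rewrite size_take_min geq_minl.
apply: eq_bigr => j _; rewrite !mxE/= nth_take// /cofactor/= !add0n mulrCA.
congr (_ * (_ * _)); rewrite -IHn; congr (\det _).
apply/matrixP => i k; rewrite !mxE/=; congr odflt.
have [iM|Mi] := ltnP i (size M); last first.
  by rewrite !nth_default ?size_map ?nth_nil// leqW.
by rewrite (nth_map [::])// nth_drop_col.
Qed.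

End SparseDeterminant.

(** * The vertex determinant as a polynomial *)

(** With [alphaV] and [betaV] standing for the inverse multipliers, the formula becomes a polynomial
    identity modulo eight relations. Each relation has a monomial on its left, so that [ring] can
    use it as a rewrite rule. *)
Lemma det_vertex_matrix (K : comNzRingType) (alpha alphaV beta betaV : K)
    (C C' S S' : 'I_6 -> K) :
  (forall j, C j * S' j = 1 + S j * C' j) ->
  alpha * alphaV = 1 -> beta * betaV = 1 ->
  let C1 := C e1 in let C1' := C' e1 in let S1 := S e1 in let S1' := S' e1 in
  let C2 := C e2 in let C2' := C' e2 in let S2 := S e2 in let S2' := S' e2 in
  let C3 := C e3 in let C3' := C' e3 in let S3 := S e3 in let S3' := S' e3 in
  let C4 := C e4 in let C4' := C' e4 in let S4 := S e4 in let S4' := S' e4 in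
  let C5 := C e5 in let C5' := C' e5 in let S5 := S e5 in let S5' := S' e5 in
  let C6 := C e6 in let C6' := C' e6 in let S6 := S e6 in let S6' := S' e6 in
  let CS i j := C i * S j + S i * C j in
  let CS' i j := C i * S' j + S i * C' j in
  let CSS i j k := C i * S j * S k + C j * S k * S i + C k * S i * S j in
  \det (vertex_matrix alpha beta C C' S S') =
  alpha * beta *
  ((S5' * S2 * S3 + S5 * CS e2 e3) *
     (C1' * der2 (S4, S4') (S6, S6') + S1' * der2 (C4, C4') (S6, S6')
      + S1 * der2 (C4, C4') (C6, C6') + C1 * der2 (S4, S4') (C6, C6')
      - (beta + betaV))
   + CSS e1 e4 e5 *
     (S2' * der2 (C3, C3') (S6, S6') + C2' * der2 (S3, S3') (S6, S6')
      + C6 * CS' e2 e3 - (beta + betaV))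
   + (C6 * S1 * S2 + S6 * der2 (S1, S1') (S2, S2')) *
     (C5' * der2 (S3, S3') (S4, S4') + C3 * S4' * C5 + S3' * C4 * S5'
      - (alpha + alphaV))
   + der3 (S3, S3') (S4, S4') (S6, S6') *
     (C1 * S2' * S5' + S1' * C2 * C5 - (alpha + alphaV))
   + S5 * S6 * (CS' e1 e4 * CS' e3 e2 + CS' e4 e1 * CS' e2 e3 - 2)
   + S2 * S4 *
     ((S1' * S6' + S1 * C6') * (C3 * C5 + S3 * C5')
      + S6 * (C1' * S3' * S5' + S1' * C3' * C5) + C1 * C6 * S3' * S5'
      - (alpha * betaV + alphaV * beta))
   + S1 * S3 *
     (S2' * S6' * CS' e4 e5 + C2 * C5 * der2 (S4, S4') (C6, C6')
      + S6 * (C2' * S4' * C5 + S2' * C4' * S5')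
      - (alpha * beta + alphaV * betaV))).
Proof.
move=> W ha hb C1 C1' S1 S1' C2 C2' S2 S2' C3 C3' S3 S3' C4 C4' S4 S4'.
move=> C5 C5' S5 S5' C6 C6' S6 S6' CS CS' CSS.
have -> : vertex_matrix alpha beta C C' S S' = sparse_mx 12
  (let o := Some (1 : K) in let m := Some (- 1 : K) in let z := None in
  [:: [:: o; z; z; m; z; z; z; z; z; z; z; z];
      [:: o; z; z; z; m; z; z; z; z; z; z; z];
      [:: z; z; z; z; z; z; o; z; z; o; o; z];
      [:: Some C1; z; z; z; z; m; Some S1; z; z; z; z; z];
      [:: z; Some C2; z; z; z; m; z; Some S2; z; z; z; z];
      [:: Some C1'; Some C2'; z; z; z; z; Some S1'; Some S2'; z; z; z; m];
      [:: z; o; m; z; z; z; z; z; z; z; z; z];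
      [:: z; m; z; z; Some (alpha * C5); z; z; z; z; z; Some (alpha * S5); z];
      [:: z; z; z; z; Some (alpha * C5'); z; z; m; m; z; Some (alpha * S5'); z];
      [:: z; z; Some (- C3); Some C4; z; z; z; z; Some (- S3); Some S4; z; z];
      [:: z; z; Some (- C3); z; z; Some (beta * C6);
          z; z; Some (- S3); z; z; Some (beta * S6)];
      [:: z; z; Some C3'; Some C4'; z; Some (beta * C6');
          z; z; Some S3'; Some S4'; z; Some (beta * S6')]]).
  apply/matrixP => i j; rewrite !mxE.
  case: i => [i hi]; case: j => [j hj] /=.
  (* The 144 entries are compared one by one: at a basis vector each form reduces to a single
     coefficient. *)
  do 12?[case: i hi => [|i] hi //=]; do 12?[case: j hj => [|j] hj //=].
  all: rewrite /= ?mulr0n ?mulr1n ?mulr0 ?mulr1 ?oppr0 ?addr0 ?add0r.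
  all: rewrite ?subr0 ?sub0r //.
rewrite det_sparse_mx.
(* Only the list program is unfolded; the ring operations stay folded, leaving a polynomial
   expression in the entries. *)
lazy [sparse_det sparse_row_sum sparse_mul sparse_sub drop_col map take drop cat
      odflt oapp].
move: (W e1) (W e2) (W e3) (W e4) (W e5) (W e6).
rewrite /CSS /CS /CS' /der2 /der3 /=.
rewrite -/C1 -/C2 -/C3 -/C4 -/C5 -/C6 -/S1 -/S2 -/S3 -/S4 -/S5 -/S6.
rewrite -/C1' -/C2' -/C3' -/C4' -/C5' -/C6'.
rewrite -/S1' -/S2' -/S3' -/S4' -/S5' -/S6'.
(* The 24 boundary values become plain variables, tied only by the Wronskian relations. *)
clearbody C1 C2 C3 C4 C5 C6 S1 S2 S3 S4 S5 S6.
clearbody C1' C2' C3' C4' C5' C6' S1' S2' S3' S4' S5' S6'.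
move=> w1 w2 w3 w4 w5 w6.
ring: w1 w2 w3 w4 w5 w6 ha hb.
Qed.

(** * Fubini's theorem on the triangle *)

(** By Tonelli the iterated integral of the absolute value is the product of the two [L^1] norms,
    hence finite. *)
Lemma integrable_prod_mul d1 d2 (T1 : measurableType d1)
    (T2 : measurableType d2) (R : realType)
    (m1 : {sigma_finite_measure set T1 -> \bar R})
    (m2 : {sigma_finite_measure set T2 -> \bar R}) (u : T1 -> R) (v : T2 -> R) :
  m1.-integrable setT (EFin \o u) -> m2.-integrable setT (EFin \o v) ->
  (m1 \x m2)%E.-integrable setT (EFin \o (fun z => u z.1 * v z.2)).
Proof.
move=> /integrableP[/measurable_EFinP mu fu].
move=> /integrableP[/measurable_EFinP mv fv].
have mz : measurable_fun setT (EFin \o (fun z : T1 * T2 => u z.1 * v z.2)).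
  apply/measurable_EFinP/measurable_funM.
    exact: measurableT_comp mu measurable_fst.
  exact: measurableT_comp mv measurable_snd.
apply/(integrable12ltyP _ _ mz) => /=.
under eq_integral => x _.
  under eq_integral => y _ do rewrite normrM EFinM.
  rewrite ge0_integralZl_EFin//; last first.
    by apply/measurable_EFinP; exact: measurableT_comp.
  over.
rewrite ge0_integralZr//; last 2 first.
- by apply/measurable_EFinP; exact: measurableT_comp.
- exact: integral_ge0.
by rewrite lte_mul_pinfty// ?integral_ge0// fin_num_abs gee0_abs ?integral_ge0.
Qed.

Section FubiniTriangle.
Context {R : realType}.
Local Notation mu := (@lebesgue_measure R).
Context (u v : R -> R) (iu : mu.-integrable setT (EFin \o u))
  (iv : mu.-integrable setT (EFin \o v)).

Definition triangle : set (R * R) := [set z | z.2 <= z.1].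
Definition triangle_mul z := ((fun z => u z.1 * v z.2) \_ triangle) z.

Lemma integrable_triangle :
  (mu \x mu)%E.-integrable setT (EFin \o triangle_mul).
Proof.
have mT : measurable (triangle : set (measurableTypeR R * measurableTypeR R)).
  by rewrite -[triangle]setTI; exact: measurable_fun_le.
rewrite -restrict_EFin; apply/(integrable_mkcond _ mT).1 => //.
by apply: (integrableS measurableT) => //; exact: integrable_prod_mul.
Qed.

Let integrable_sub w (D : set R) : measurable D ->
  mu.-integrable setT (EFin \o w) -> mu.-integrable D (EFin \o w).
Proof. by move=> mD; exact: integrableS. Qed.

(** At fixed [x] the triangle is cut in the ray []-oo, x]], so the inner integral is a primitive of
    [v]. *)
Lemma triangle_sectionx x :
  (\int[mu]_y (triangle_mul (x, y))%:E =
   (u x * \int[mu]_(y in `]-oo, x]) v y)%:E)%E.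
Proof.
have iD : mu.-integrable `]-oo, x] (EFin \o v) by exact: integrable_sub.
transitivity (\int[mu]_y (((fun y => u x * v y) \_ `]-oo, x]) y)%:E)%E.
  apply: eq_integral => y _; rewrite /triangle_mul /= !patchE.
  by rewrite (_ : ((x, y) \in triangle) = (y \in `]-oo, x]%classic))//.
rewrite -RintegralZl// Rintegral_mkcond /Rintegral fineK//.
apply: integrable_fin_num => //; rewrite -[X in integrable _ _ X]/(EFin \o _).
rewrite -restrict_EFin; apply/(integrable_mkcond _ _).1 => //.
exact: integrableZl iD.
Qed.

Lemma triangle_sectiony y : (\int[mu]_x (triangle_mul (x, y))%:E =
  ((\int[mu]_x u x - \int[mu]_(x in `]-oo, y]) u x) * v y)%:E)%E.
Proof.
have iD : mu.-integrable `[y, +oo[ (EFin \o u) by exact: integrable_sub.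
transitivity (\int[mu]_x (((fun x => u x * v y) \_ `[y, +oo[) x)%:E)%E.
  apply: eq_integral => x _; rewrite /triangle_mul /= !patchE.
  rewrite (_ : ((x, y) \in triangle) = (x \in `[y, +oo[%classic))//.
  by apply/idP/idP; rewrite !inE /triangle/= in_itv/= andbT.
have -> : \int[mu]_x u x - \int[mu]_(x in `]-oo, y]) u x =
   \int[mu]_(x in `[y, +oo[) u x.
  (* Passing to []y, +oo[] drops a null set; the line is then the disjoint union of the two rays. *)
  rewrite -Rintegral_itv_obnd_cbnd; last exact: integrable_sub.
  by rewrite -set_itvNyy Rintegral_itvB// ?set_itvNyy.
rewrite -RintegralZr// Rintegral_mkcond /Rintegral fineK//.
apply: integrable_fin_num => //; rewrite -[X in integrable _ _ X]/(EFin \o _).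
rewrite -restrict_EFin; apply/(integrable_mkcond _ _).1 => //.
exact: integrableZr iD.
Qed.

(** The function is the [x]-marginal of [triangle_mul], and Fubini makes the marginal of an
    integrable function integrable. *)
Lemma integrable_mul_primitive :
  mu.-integrable setT (EFin \o (fun x => u x * \int[mu]_(y in `]-oo, x]) v y)).
Proof.
rewrite (_ : _ \o _ = fubini_F mu (EFin \o triangle_mul)).
  exact: integrable_fubini_F integrable_triangle.
by apply/funext => x; rewrite /fubini_F/= triangle_sectionx.
Qed.

End FubiniTriangle.

(** * Product rule and Lagrange identity for absolutely continuous functions *)

Section ProductRule.
Context {R : realType}.
Local Notation mu := (@lebesgue_measure R).
Implicit Types (u v f g : R -> R).

(** Integration by parts on the line. Exchanging the order of integration turns the first term into
    the integral of the complementary primitive of [u] times [v]; adding the second term restores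
    the full integral of [u]. *)
Lemma fubini_triangle u v :
  mu.-integrable setT (EFin \o u) -> mu.-integrable setT (EFin \o v) ->
  \int[mu]_x u x * \int[mu]_x v x =
  \int[mu]_x (u x * \int[mu]_(y in `]-oo, x]) v y) +
  \int[mu]_y (\int[mu]_(x in `]-oo, y]) u x * v y).
Proof.
move=> iu iv.
have -> : \int[mu]_x (u x * \int[mu]_(y in `]-oo, x]) v y) =
    \int[mu]_y ((\int[mu]_x u x - \int[mu]_(x in `]-oo, y]) u x) * v y).
  congr fine; under eq_integral do rewrite -triangle_sectionx//.
  rewrite (Fubini (integrable_triangle iu iv)).
  by apply: eq_integral => y _; rewrite triangle_sectiony.
have ivU := integrable_mul_primitive iv iu.
under [X in _ = X + _]eq_Rintegral do rewrite mulrBl.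
rewrite RintegralB//.
- by rewrite RintegralZl// subrK.
- exact: integrableZl iv.
- by apply: eq_integrable ivU => // x _ /=; rewrite mulrC.
Qed.

(** Extension by zero moves the problem from [[0, a]] to the whole line, where the triangle identity
    is available. *)
Lemma integrable_patch a u : mu.-integrable `[0, a] (EFin \o u) ->
  mu.-integrable setT (EFin \o (u \_ `[0, a])).
Proof.
by move=> iu; rewrite -restrict_EFin; apply/(integrable_mkcond _ _).1.
Qed.

Lemma Rintegral_primitive_restrict a x u : x \in `[0, a] ->
  \int[mu]_(y in `]-oo, x]) (u \_ `[0, a]) y = \int[mu]_(y in `[0, x]) u y.
Proof.
move=> /[!in_itv]/= /andP[x0 xa]; rewrite -Rintegral_mkcondr.
congr Rintegral; apply/seteqP; split => y /=; rewrite !in_itv/=.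
  by move=> [yx /andP[-> _]].
by move=> /andP[-> yx]; split=> //; exact: le_trans xa.
Qed.

Lemma integrable_itv_mul_primitive a u v :
  mu.-integrable `[0, a] (EFin \o u) -> mu.-integrable `[0, a] (EFin \o v) ->
  mu.-integrable `[0, a]
    (EFin \o (fun x => u x * \int[mu]_(y in `[0, x]) v y)).
Proof.
move=> iu iv; apply/(integrable_mkcond _ _).2 => //.
rewrite restrict_EFin.
apply: eq_integrable
  (integrable_mul_primitive (integrable_patch iu) (integrable_patch iv)) => //.
move=> x _ /=; rewrite !patchE; case: ifPn => [|_]; last by rewrite mul0r.
by rewrite inE => xa; rewrite Rintegral_primitive_restrict.
Qed.

Lemma Rintegral_mul_primitive a u v :
  mu.-integrable `[0, a] (EFin \o u) -> mu.-integrable `[0, a] (EFin \o v) ->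
  \int[mu]_(x in `[0, a]) u x * \int[mu]_(x in `[0, a]) v x =
  \int[mu]_(x in `[0, a]) (u x * \int[mu]_(y in `[0, x]) v y) +
  \int[mu]_(x in `[0, a]) (\int[mu]_(y in `[0, x]) u y * v x).
Proof.
move=> iu iv.
rewrite [X in X * _ = _]Rintegral_mkcond [X in _ * X = _]Rintegral_mkcond.
rewrite (fubini_triangle (integrable_patch iu) (integrable_patch iv)).
rewrite [X in _ = X + _]Rintegral_mkcond [X in _ = _ + X]Rintegral_mkcond.
apply: f_equal2; apply: eq_Rintegral => x _; rewrite !patchE.
- case: ifPn => [|_]; last by rewrite mul0r.
  by rewrite inE => xa; rewrite Rintegral_primitive_restrict.
- case: ifPn => [|_]; last by rewrite mulr0.
  by rewrite inE => xa; rewrite Rintegral_primitive_restrict.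
Qed.

(** Real counterpart of [ac_derivative], meant for real and imaginary parts. *)
Definition real_ac a f u := mu.-integrable `[0, a] (EFin \o u) /\
  forall x, x \in `[0, a] -> f x = f 0 + \int[mu]_(t in `[0, x]) u t.

Lemma real_ac_integrable a f u v : real_ac a f u ->
  mu.-integrable `[0, a] (EFin \o v) ->
  mu.-integrable `[0, a] (EFin \o (fun x => f x * v x)).
Proof.
move=> [iu fE] iv.
have mD : measurable (`[0, a]%classic : set (measurableTypeR R)) by [].
have i1 : mu.-integrable `[0, a] (EFin \o (fun x => f 0 * v x)).
  exact: integrableZl iv.
apply: (eq_integrable mD _ _ _
  (integrableD mD i1 (integrable_itv_mul_primitive iv iu))).
move=> x; rewrite inE => xa /=.
by rewrite (fE x xa) -EFinD mulrDl [v x * _]mulrC.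
Qed.

Lemma real_ac_Rintegral_mul a f u v : real_ac a f u ->
  mu.-integrable `[0, a] (EFin \o v) ->
  \int[mu]_(x in `[0, a]) (f x * v x) =
  f 0 * \int[mu]_(x in `[0, a]) v x +
  \int[mu]_(x in `[0, a]) (\int[mu]_(y in `[0, x]) u y * v x).
Proof.
move=> [iu fE] iv; rewrite -RintegralZl// -RintegralD//.
- by apply: eq_Rintegral => x; rewrite inE => xa; rewrite (fE x xa) mulrDl.
- exact: integrableZl iv.
- apply: eq_integrable (integrable_itv_mul_primitive iv iu) => //.
  by move=> x _ /=; rewrite mulrC.
Qed.

(** Writing [f] and [g] as initial value plus primitive and expanding, the only nontrivial term is
    the product of the two integrals, which [Rintegral_mul_primitive] splits. *)
Lemma real_ac_mul a f u g v : 0 <= a -> real_ac a f u -> real_ac a g v ->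
  f a * g a = f 0 * g 0 +
    \int[mu]_(x in `[0, a]) (f x * v x) + \int[mu]_(x in `[0, a]) (g x * u x).
Proof.
move=> a0 fu gv; have [[iu fE] [iv gE]] := (fu, gv).
have aa : a \in `[0, a] by rewrite in_itv/= a0 lexx.
rewrite (real_ac_Rintegral_mul fu iv) (real_ac_Rintegral_mul gv iu).
rewrite (fE _ aa) (gE _ aa).
have := Rintegral_mul_primitive iu iv.
under [X in _ = X + _]eq_Rintegral do rewrite mulrC.
set U := \int[mu]_(x in _) u x; set V := \int[mu]_(x in _) v x => UV.
by rewrite mulrDl !mulrDr UV; ring.
Qed.

Lemma real_lagrange_integrable a f f' f'' g g' g'' :
  real_ac a f f' -> real_ac a f' f'' -> real_ac a g g' -> real_ac a g' g'' ->
  mu.-integrable `[0, a] (EFin \o (fun x => f x * g'' x - g x * f'' x)).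
Proof.
move=> hf hf' hg hg'.
have mD : measurable (`[0, a]%classic : set (measurableTypeR R)) by [].
exact: (integrableB mD (real_ac_integrable hf hg'.1)
  (real_ac_integrable hg hf'.1)).
Qed.

(** Difference of the product rules for [f * g'] and [g * f']: the two integrals of [f' * g']
    cancel. *)
Lemma real_lagrange a f f' f'' g g' g'' : 0 <= a ->
  real_ac a f f' -> real_ac a f' f'' -> real_ac a g g' -> real_ac a g' g'' ->
  f a * g' a - g a * f' a = f 0 * g' 0 - g 0 * f' 0 +
    \int[mu]_(x in `[0, a]) (f x * g'' x - g x * f'' x).
Proof.
move=> a0 hf hf' hg hg'.
rewrite (real_ac_mul a0 hf hg') (real_ac_mul a0 hg hf').
rewrite RintegralB//; last 2 first.
- exact: real_ac_integrable hf hg'.1.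
- exact: real_ac_integrable hg hf'.1.
under [X in _ + _ + X - _ = _]eq_Rintegral do rewrite mulrC.
ring.
Qed.

End ProductRule.

(** * Constancy of the Wronskian *)

Section Wronskian.
Local Open Scope complex_scope.
Context {R : realType}.
Local Notation mu := (@lebesgue_measure R).
Local Notation Re := (@complex.Re R).
Local Notation Im := (@complex.Im R).

Lemma ac_derivative_Re a (y y' : R -> R[i]) :
  ac_derivative a y y' -> real_ac a (Re \o y) (Re \o y').
Proof.
move=> [[iR iI] yE]; split=> // x xa /=.
by rewrite yE//; case: (y 0).
Qed.

Lemma ac_derivative_Im a (y y' : R -> R[i]) :
  ac_derivative a y y' -> real_ac a (Im \o y) (Im \o y').
Proof.
move=> [[iR iI] yE]; split=> // x xa /=.
by rewrite yE//; case: (y 0).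
Qed.

#[local] Instance ae_lebesgue_filter : Filter (nbhs (almost_everywhere mu)).
Proof. exact: (ae_filter_ringOfSetsType mu). Qed.

Lemma Rintegral_ae0 (D : set R) (f : R -> R) : measurable D ->
  mu.-integrable D (EFin \o f) -> {ae mu, forall x, D x -> f x = 0} ->
  \int[mu]_(x in D) f x = 0.
Proof.
move=> mD /measurable_int mf f0; rewrite /Rintegral.
rewrite (@ae_eq_integral _ _ _ mu D (cst 0%E))//; last first.
  by move: f0; apply: filterS => x /[apply] /= ->.
by rewrite integral0.
Qed.

(** The equation is imposed on the open interval but integrated over the closed one; the two
    endpoints are null. *)
Lemma ae_itv_oo_cc (a : R) (P : R -> Prop) :
  {ae mu, forall x, x \in `]0, a[ -> P x} ->
  {ae mu, forall x, `[0, a]%classic x -> P x}.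
Proof.
move=> h.
have n b : {ae mu, forall x, x <> b}.
  exists [set b]; split => //; first exact: lebesgue_measure_set1.
  by move=> x /= /contrapT.
apply: (filterS3 _ _ h (n 0) (n a)) => x Px x0 xa.
rewrite /= in_itv/= => /andP[h0 ha].
apply: Px; rewrite in_itv/= !lt_neqAle h0 ha !andbT.
by rewrite eq_sym; apply/andP; split; apply/eqP.
Qed.

(** Both second derivatives are [q - lambda] times the function almost everywhere, so the integrand
    [y * z'' - z * y''] of the Lagrange identity vanishes. *)
Lemma SL_wronskian (a : R) q lambda (y y' z z' : R -> R[i]) : 0 <= a ->
  SL_solution a q lambda y y' -> SL_solution a q lambda z z' ->
  y a * z' a - z a * y' a = y 0 * z' 0 - z 0 * y' 0.
Proof.
move=> a0 [y'' [hy hy' ey]] [z'' [hz hz' ez]].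
have [yR yI] := (ac_derivative_Re hy, ac_derivative_Im hy).
have [y'R y'I] := (ac_derivative_Re hy', ac_derivative_Im hy').
have [zR zI] := (ac_derivative_Re hz, ac_derivative_Im hz).
have [z'R z'I] := (ac_derivative_Re hz', ac_derivative_Im hz').
have e : {ae mu, forall x, `[0, a]%classic x -> y x * z'' x = z x * y'' x}.
  apply: ae_itv_oo_cc; apply: (filterS2 _ _ ey ez) => x eyx ezx xa.
  have -> : y'' x = (q x)%:C * y x - lambda * y x by rewrite -eyx//; ring.
  have -> : z'' x = (q x)%:C * z x - lambda * z x by rewrite -ezx//; ring.
  ring.
(* The real identity is applied to the four pairings of real and imaginary parts. By bilinearity,
   Re-Re minus Im-Im is the real part of the complex integrand, and the sum of the mixed pairings
   its imaginary part. *)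
have RRI := real_lagrange_integrable yR y'R zR z'R.
have III := real_lagrange_integrable yI y'I zI z'I.
have RII := real_lagrange_integrable yR y'R zI z'I.
have IIR := real_lagrange_integrable yI y'I zR z'R.
have lRR := real_lagrange a0 yR y'R zR z'R.
have lII := real_lagrange a0 yI y'I zI z'I.
have lRI := real_lagrange a0 yR y'R zI z'I.
have lIR := real_lagrange a0 yI y'I zR z'R.
have mD : measurable (`[0, a]%classic : set (measurableTypeR R)) by [].
have := Rintegral_ae0 mD (integrableB mD RRI III) _.
rewrite RintegralB// => /(_ _)/wrap[].
  move: e; apply: filterS => x /[apply] /=.
  case: (y x) (z x) (y'' x) (z'' x) => [? ?] [? ?] [? ?] [? ?] [] /=.
  lra.
have := Rintegral_ae0 mD (integrableD mD RII IIR) _.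
rewrite RintegralD// => /(_ _)/wrap[].
  move: e; apply: filterS => x /[apply] /=.
  case: (y x) (z x) (y'' x) (z'' x) => [? ?] [? ?] [? ?] [? ?] [] /=.
  lra.
move: lRR lII lRI lIR => /=.
case: (y a) (z a) (y' a) (z' a) => [? ?] [? ?] [? ?] [? ?] /=.
case: (y 0) (z 0) (y' 0) (z' 0) => [? ?] [? ?] [? ?] [? ?] /=.
move=> lRR lII lRI lIR eI eR.
(* With products of boundary values and integrals as atoms, each component is a linear consequence
   of the four identities and the two vanishing integrals. *)
apply/eqP; rewrite eq_complex/=; apply/andP; split; apply/eqP; lra.
Qed.

End Wronskian.

(** * Floquet multipliers and Euler's formula *)

Section Euler.
Local Open Scope complex_scope.
Context {R : realType}.
Implicit Types s t : R.

Lemma expiD s t : expi (s + t) = expi s * expi t.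
Proof.
rewrite /expi cosD sinD; apply/eqP; rewrite eq_complex/= eqxx/=.
by apply/eqP; ring.
Qed.

(** Supplies the inverse multipliers [alphaV] and [betaV] of [det_vertex_matrix]. *)
Lemma expi_mulVr t : expi t * expi (- t) = 1.
Proof. by rewrite -expiD subrr /expi cos0 sin0. Qed.

Lemma expiD_expiN t : expi t + expi (- t) = (2 * cos t)%:C.
Proof.
rewrite /expi cosN sinN; apply/eqP; rewrite eq_complex/= subrr eqxx andbT.
by apply/eqP; ring.
Qed.

End Euler.

Theorem theorem4p1 (R : realType) (a : R) (a_gt0 : 0 < a)
    (q : 'I_6 -> R -> R) (q_L2 : forall j, square_integrable a (q j))
    (C C' S S' : 'I_6 -> R -> R[i] -> R[i])
    (C_sol : forall j rho,
       SL_cauchy a (q j) (rho ^+ 2) 1 0 (C j ^~ rho) (C' j ^~ rho))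
    (S_sol : forall j rho,
       SL_cauchy a (q j) (rho ^+ 2) 0 1 (S j ^~ rho) (S' j ^~ rho))
    (theta1 theta2 : R)
    (theta1_pi : theta1 \in `[- pi, pi]) (theta2_pi : theta2 \in `[- pi, pi])
    (rho : R[i]) :
  let C1 := C e1 a rho in let C1' := C' e1 a rho in
  let C2 := C e2 a rho in let C2' := C' e2 a rho in
  let C3 := C e3 a rho in let C3' := C' e3 a rho in
  let C4 := C e4 a rho in let C4' := C' e4 a rho in
  let C5 := C e5 a rho in let C5' := C' e5 a rho in
  let C6 := C e6 a rho in let C6' := C' e6 a rho in
  let S1 := S e1 a rho in let S1' := S' e1 a rho in
  let S2 := S e2 a rho in let S2' := S' e2 a rho in
  let S3 := S e3 a rho in let S3' := S' e3 a rho in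
  let S4 := S e4 a rho in let S4' := S' e4 a rho in
  let S5 := S e5 a rho in let S5' := S' e5 a rho in
  let S6 := S e6 a rho in let S6' := S' e6 a rho in
  let CS i j := C i a rho * S j a rho + S i a rho * C j a rho in
  let CS' i j := C i a rho * S' j a rho + S i a rho * C' j a rho in
  let CSS i j k :=
    C i a rho * S j a rho * S k a rho + C j a rho * S k a rho * S i a rho
    + C k a rho * S i a rho * S j a rho in
  let two_cos (t : R) : R[i] := (2 * cos t)%:C in
  char_fun a theta1 theta2 C C' S S' rho =
  expi (theta1 + theta2) *
  ((S5' * S2 * S3 + S5 * CS e2 e3) *
     (C1' * der2 (S4, S4') (S6, S6') + S1' * der2 (C4, C4') (S6, S6')
      + S1 * der2 (C4, C4') (C6, C6') + C1 * der2 (S4, S4') (C6, C6')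
      - two_cos theta2)
   + CSS e1 e4 e5 *
     (S2' * der2 (C3, C3') (S6, S6') + C2' * der2 (S3, S3') (S6, S6')
      + C6 * CS' e2 e3 - two_cos theta2)
   + (C6 * S1 * S2 + S6 * der2 (S1, S1') (S2, S2')) *
     (C5' * der2 (S3, S3') (S4, S4') + C3 * S4' * C5 + S3' * C4 * S5'
      - two_cos theta1)
   + der3 (S3, S3') (S4, S4') (S6, S6') *
     (C1 * S2' * S5' + S1' * C2 * C5 - two_cos theta1)
   + S5 * S6 * (CS' e1 e4 * CS' e3 e2 + CS' e4 e1 * CS' e2 e3 - 2)
   + S2 * S4 *
     ((S1' * S6' + S1 * C6') * (C3 * C5 + S3 * C5')
      + S6 * (C1' * S3' * S5' + S1' * C3' * C5) + C1 * C6 * S3' * S5'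
      - two_cos (theta1 - theta2))
   + S1 * S3 *
     (S2' * S6' * CS' e4 e5 + C2 * C5 * der2 (S4, S4') (C6, C6')
      + S6 * (C2' * S4' * C5 + S2' * C4' * S5')
      - two_cos (theta1 + theta2))).
Proof.
have W j : C j a rho * S' j a rho = 1 + S j a rho * C' j a rho.
  have [c_sol c0 c'0] := C_sol j rho; have [s_sol s0 s'0] := S_sol j rho.
  (* The Cauchy data at 0 give the Wronskian the value [1 * 1 - 0 * 0]. *)
  have := SL_wronskian (ltW a_gt0) c_sol s_sol.
  by rewrite c0 c'0 s0 s'0 mulr1 mulr0 subr0 => /eqP; rewrite subr_eq => /eqP.
rewrite /= /char_fun (det_vertex_matrix W (expi_mulVr _) (expi_mulVr _)).
(* Euler's formula read backwards: each cosine becomes a sum of two inverse exponentials, and those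
   of [theta1 + theta2] and [theta1 - theta2] split into products of multipliers. *)
rewrite expiD -!expiD_expiN !opprD opprK !expiD.
by rewrite [expi (- theta1) * expi theta2]mulrC.
Qed.
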